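(* Let $k$ be an infinite field and let $G$ be a connected graph on the vertices $x_1,\ldots,x_s$ containing a unique cycle, which is of even length $d\ge 4$ and has edges $e_i=x_ix_{i+1}$ for $1\le i<d$ and $e_d=x_1x_d$. Assume further that $x_j$ is a leaf for all $j>d$, so that for each $j>d$ there is a unique vertex $x_{i_j}$ with $1\le i_j\le d$ such that $e_j=x_{i_j}x_j$ is an edge of $G$ (the $i_j$ need not be distinct, and $s=d$ is allowed). Let $R=k[x_1,\ldots,x_s]_{(x_1,\ldots,x_s)}$, let $\mathfrak{m}$ be its maximal ideal, and let $I=(e_1,\ldots,e_s)\subset R$ be the edge ideal of $G$. Then $\mathrm{core}(I)=(J:I)I=\mathfrak{m}I$ for any minimal reduction $J$ of $I$.
   Context: Edges are identified with the corresponding monomials $x_ix_j\in R$, and the edge ideal is generated by these monomials. A reduction of an ideal $I$ is an ideal $J\subset I$ with $I^{r+1}=JI^r$ for some integer $r\ge 0$; a minimal reduction is a reduction that is minimal with respect to inclusion among reductions of $I$. The core of $I$, $\mathrm{core}(I)$, is the intersection of all reductions of $I$; over a Noetherian local ring it equals the intersection of all minimal reductions. *)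

(* Defs.v *)
From HB Require Import structures.
From mathcomp Require Import all_boot all_order all_algebra.
From mathcomp Require Import boolp classical_sets cardinality.
From mathcomp Require Import mpoly.

Set Implicit Arguments.
Unset Strict Implicit.
Unset Printing Implicit Defensive.

Import GRing.Theory.
Local Open Scope ring_scope.

Section Graph.
Variable T : finType.
Implicit Types (e : rel T) (c : seq T).

Definition simple_graph e : Prop := ssrbool.symmetric e /\ irreflexive e.

Definition connected_graph e : Prop := forall x y, connect e x y.

Definition graph_cycle e c : bool := (2 < size c)%N && ucycleb e c.

(* A cycle, as a subgraph, is determined by its set of edges; this identifies
   the closed walks that differ by the base point or by the orientation. *)
Definition cycle_edges c : {set {set T}} :=
  [set [set x; next c x]%SET | x in c]%SET.

Definition unique_cycle e (C : {set {set T}}) : Prop :=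
  (exists2 c, graph_cycle e c & cycle_edges c = C) /\
  (forall c, graph_cycle e c -> cycle_edges c = C).

Definition leaf e (x : T) : Prop := #|[set y | e x y]%SET| = 1%N.

End Graph.

(* The d edges {0, 1}, ..., {d - 2, d - 1}, {d - 1, 0} on the first d
   vertices (vertices are numbered from 0). *)
Definition first_cycle (s d : nat) : {set {set 'I_s}} :=
  [set [set p.1; p.2]%SET
     | p : 'I_s * 'I_s & (p.1 < d)%N && (p.2 == (p.1.+1 %% d)%N :> nat)]%SET.

Local Open Scope classical_set_scope.

Section Ideals.
Variable R : comNzRingType.
Implicit Types (A I J m : set R).

Definition is_ideal I : Prop :=
  [/\ I 0, forall x y, I x -> I y -> I (x + y) & forall a x, I x -> I (a * x)].

Definition ideal_gen A : set R :=
  [set x | exists (n : nat) (a f : 'I_n -> R),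
     (forall i, A (f i)) /\ x = \sum_i a i * f i].

Definition ideal_mul I J : set R :=
  ideal_gen [set x | exists2 a, I a & exists2 b, J b & x = a * b].

Fixpoint ideal_exp I (n : nat) : set R :=
  if n is n'.+1 then ideal_mul I (ideal_exp I n') else setT.

Definition ideal_colon J I : set R := [set x | forall y, I y -> J (x * y)].

Definition maximal_ideal m : Prop :=
  [/\ is_ideal m, m <> setT &
      forall I, is_ideal I -> m `<=` I -> I = m \/ I = setT].

Definition reduction J I : Prop :=
  [/\ is_ideal J, J `<=` I &
      exists r : nat, ideal_exp I r.+1 = ideal_mul J (ideal_exp I r)].

Definition minimal_reduction J I : Prop :=
  reduction J I /\ (forall J', reduction J' I -> J' `<=` J -> J' = J).

Definition core I : set R := \bigcap_(J in [set J | reduction J I]) J.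

End Ideals.

Local Notation "x %:F" := (@FracField.tofrac _ x) : ring_scope.

(* The localization of k[x_1, ..., x_n] at (x_1, ..., x_n), as the subring of
   the fraction field of the p / q with q outside of (x_1, ..., x_n), that is,
   with nonzero constant coefficient. *)
Section Localization.
Variables (k : fieldType) (n : nat).

Definition local_pred : {pred {fraction {mpoly k[n]}}} :=
  fun f => `[< exists p q : {mpoly k[n]}, q@_0%MM != 0 /\ f = p%:F / q%:F >].

Record local_mpoly := LocalMPoly {
  local_val :> {fraction {mpoly k[n]}};
  _ : local_val \in local_pred }.

HB.instance Definition _ := [isSub for local_val].
HB.instance Definition _ := [Choice of local_mpoly by <:].

Lemma local_predP f : reflect
  (exists p q : {mpoly k[n]}, q@_0%MM != 0 /\ f = p%:F / q%:F)
  (f \in local_pred).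
Proof. exact: asboolP. Qed.

Lemma tofrac_neq0 (q : {mpoly k[n]}) : q@_0%MM != 0 -> q%:F != 0.
Proof. by rewrite tofrac_eq0; apply: contraNneq => ->; rewrite mcoeff0. Qed.

Lemma mcoeff0M (p q : {mpoly k[n]}) : (p * q)@_0%MM = p@_0%MM * q@_0%MM.
Proof. exact: rmorphM. Qed.

Lemma local_subring_closed : subring_closed local_pred.
Proof.
split.
- apply/local_predP; exists 1, 1; rewrite mcoeff1 eqxx oner_neq0.
  by rewrite tofrac1 divr1.
- move=> x y /local_predP[p [q [q0 ->]]] /local_predP[p' [q' [q'0 ->]]].
  apply/local_predP; exists (p * q' - p' * q), (q * q').
  rewrite mcoeff0M mulf_neq0 //; split=> //.
  by rewrite -mulNr addf_div ?tofrac_neq0 // tofracB !tofracM mulNr.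
- move=> x y /local_predP[p [q [q0 ->]]] /local_predP[p' [q' [q'0 ->]]].
  apply/local_predP; exists (p * p'), (q * q').
  by rewrite mcoeff0M mulf_neq0 // !tofracM mulf_div.
Qed.

HB.instance Definition _ :=
  GRing.isSubringClosed.Build _ local_pred local_subring_closed.
HB.instance Definition _ := [SubChoice_isSubComNzRing of local_mpoly by <:].

Lemma local_valD (x y : local_mpoly) :
  local_val (x + y) = local_val x + local_val y.
Proof. by []. Qed.

Lemma local_valM (x y : local_mpoly) :
  local_val (x * y) = local_val x * local_val y.
Proof. by []. Qed.

Lemma tofrac_local (p : {mpoly k[n]}) : p%:F \in local_pred.
Proof.
by apply/local_predP; exists p, 1; rewrite mcoeff1 eqxx oner_neq0 tofrac1 divr1.
Qed.

Definition to_local (p : {mpoly k[n]}) : local_mpoly :=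
  LocalMPoly (tofrac_local p).

Lemma to_local_is_zmod_morphism : zmod_morphism to_local.
Proof. by move=> p q; apply: val_inj; rewrite /= tofracB. Qed.

Lemma to_local_is_monoid_morphism : monoid_morphism to_local.
Proof.
by split=> [|p q]; apply: val_inj; rewrite /= ?tofrac1 ?tofracM.
Qed.

HB.instance Definition _ := GRing.isZmodMorphism.Build _ _ to_local
  to_local_is_zmod_morphism.
HB.instance Definition _ := GRing.isMonoidMorphism.Build _ _ to_local
  to_local_is_monoid_morphism.

Definition local_max : set local_mpoly :=
  [set f | exists p q : {mpoly k[n]},
     [/\ p@_0%MM = 0, q@_0%MM != 0 & local_val f = p%:F / q%:F]].

Lemma local_max_ideal : is_ideal local_max.
Proof.
split.
- exists 0, 1; rewrite mcoeff0 mcoeff1 eqxx oner_neq0; split=> //.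
  by rewrite tofrac0 mul0r.
- move=> x y [p [q [p0 q0 xE]]] [p' [q' [p'0 q'0 yE]]].
  exists (p * q' + p' * q), (q * q').
  rewrite mcoeffD !mcoeff0M p0 p'0 !mul0r addr0 mulf_neq0 //; split=> //.
  by rewrite local_valD xE yE addf_div ?tofrac_neq0 // tofracD !tofracM.
- move=> [a a_loc] x [p [q [p0 q0 xE]]].
  have /local_predP[p' [q' [q'0 aE]]] := a_loc.
  exists (p' * p), (q' * q); rewrite !mcoeff0M p0 mulr0 mulf_neq0 //; split=> //.
  by rewrite local_valM /= xE aE !tofracM mulf_div.
Qed.

Lemma local_max1 : ~ local_max 1.
Proof.
move=> [p [q [p0 q0 /(congr1 (fun z => z * q%:F))]]].
rewrite divfK ?tofrac_neq0 // mul1r => /eqP; rewrite tofrac_eq => /eqP qp.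
by move: q0; rewrite qp p0 eqxx.
Qed.

Lemma ideal_sub_local_max (J : set local_mpoly) :
  is_ideal J -> J <> setT -> J `<=` local_max.
Proof.
move=> [_ _ JM] JT f Jf; have /local_predP[p [q [q0 fE]]] := valP f.
have [p0|p0] := eqVneq p@_0%MM 0; first by exists p, q.
have g_loc : q%:F / p%:F \in local_pred by apply/local_predP; exists q, p.
case: JT; apply/seteqP; split=> // x _.
have -> : x = (x * LocalMPoly g_loc) * f; last exact: JM.
rewrite -mulrA -[LHS]mulr1; congr (_ * _); apply: val_inj.
rewrite [RHS]local_valM /= [local_val f]fE mulrA.
by rewrite divfK ?tofrac_neq0 // divff ?tofrac_neq0.
Qed.

Lemma maximal_idealE (m : set local_mpoly) :
  maximal_ideal m <-> m = local_max.
Proof.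
have maxT : local_max <> setT by move=> E; apply: local_max1; rewrite E.
split=> [[idm mT mmax]|->].
  by case: (mmax _ local_max_ideal (ideal_sub_local_max idm mT)) => // /maxT.
split=> // [|J idJ mJ]; first exact: local_max_ideal.
have [->|JT] := pselect (J = setT); [by right|left].
by apply/seteqP; split=> //; apply: ideal_sub_local_max.
Qed.

End Localization.

Definition edge_ideal (k : fieldType) (s : nat) (e : rel 'I_s) :
    set (local_mpoly k s) :=
  ideal_gen [set x | exists i j, e i j /\ x = to_local ('X_i * 'X_j)].

Arguments edge_ideal k {s} e _.

(* Main.v *)
(* Write e_i for the edges, n = d / 2, and F = T_1 T_3 ... - T_2 T_4 ... for the
   binomial of the even cycle; it generates the relations of the fiber cone of
   I. Let J be a reduction of I, let k ^ s = I / m I, and let b in k ^ s be a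
   linear form that vanishes on J. Evaluating J I ^ r = I ^ (r + 1) modulo m at
   b gives F(b) <> 0 if b <> 0, and doing so on a pencil a + t b shows that the
   forms vanishing on J make up at most a line. So J + m I contains the kernel of
   some a with F(a) <> 0: modulo J + m I all e_i are multiples a_i g of one g,
   and walking around the cycle with the linear syzygies of adjacent edges gives
   x_i g in J + m^2 I for all i, whence m I <= J by Nakayama. Conversely the
   kernel of each a with F(a) <> 0 is a reduction, and these kernels intersect
   in m I. *)
From HB Require Import structures.
Require Import Defs.
From mathcomp Require Import all_boot all_order all_algebra.
From mathcomp Require Import boolp classical_sets cardinality.
From mathcomp Require Import mpoly ring zify.

Set Implicit Arguments.
Unset Strict Implicit.
Unset Printing Implicit Defensive.

Import GRing.Theory.
Local Open Scope classical_set_scope.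
Local Open Scope ring_scope.

Local Notation "x %:F" := (@FracField.tofrac _ x) : ring_scope.

(** * The residue map of the local ring, and constants and denominators in it *)

Section ResidueField.
Variables (k : fieldType) (n : nat).
Local Notation R := (local_mpoly k n).
Implicit Types (f g : R) (p q : {mpoly k[n]}).

Lemma local_fracP f : exists pq : {mpoly k[n]} * {mpoly k[n]},
  pq.2@_0%MM != 0 /\ local_val f = pq.1%:F / pq.2%:F.
Proof. by have /local_predP[p [q pqP]] := valP f; exists (p, q). Qed.

End ResidueField.

(** Evaluation at the origin, that is, the quotient map onto $R/\mathfrak{m} = k$. It reads off a
    chosen fraction, which [residueE] shows to be immaterial; the lock keeps that choice from being
    unfolded. *)
HB.lock Definition residue (k : fieldType) (n : nat) (f : local_mpoly k n) : k :=
  let pq := projT1 (cid (local_fracP f)) in pq.1@_0%MM / pq.2@_0%MM.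

HB.lock Definition local_const (k : fieldType) (n : nat) (c : k) : local_mpoly k n :=
  to_local c%:MP.

Section ResidueMorphism.
Variables (k : fieldType) (n : nat).
Local Notation R := (local_mpoly k n).
Local Notation residue := (@residue k n).
Local Notation local_const := (@local_const k n).
Implicit Types (f g : R) (p q : {mpoly k[n]}).

Lemma residueE f p q : q@_0%MM != 0 -> local_val f = p%:F / q%:F ->
  residue f = p@_0%MM / q@_0%MM.
Proof.
rewrite unlock; case: cid => -[p' q'] /= [q'0 ->] q0 /eqP.
rewrite eqr_div ?tofrac_neq0 // -!tofracM tofrac_eq => /eqP /(congr1 (mcoeff 0)).
by rewrite !mcoeff0M => E; apply/eqP; rewrite eqr_div //; apply/eqP.
Qed.

Lemma residue_to_local p : residue (to_local p) = p@_0%MM.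
Proof.
by rewrite (@residueE _ p 1) ?mcoeff1 ?eqxx ?tofrac1 ?divr1 ?oner_neq0.
Qed.

Lemma residue_is_zmod_morphism : zmod_morphism residue.
Proof.
move=> f g; have [[p q] /= [q0 fE]] := local_fracP f.
have [[p' q'] /= [q'0 gE]] := local_fracP g.
rewrite (residueE q0 fE) (residueE q'0 gE).
have qq'0 : (q * q')@_0%MM != 0 by rewrite mcoeff0M mulf_neq0.
rewrite (@residueE _ (p * q' - p' * q) (q * q')) //.
  by apply: esym; rewrite -mulNr addf_div // mulNr mcoeffB !mcoeff0M.
transitivity (local_val f - local_val g) => //.
by rewrite fE gE -mulNr addf_div ?tofrac_neq0 // tofracB !tofracM mulNr.
Qed.

Lemma residue_is_monoid_morphism : monoid_morphism residue.
Proof.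
split=> [|f g]; first by rewrite -(rmorph1 (@to_local k n)) residue_to_local mcoeff1 eqxx.
have [[p q] /= [q0 fE]] := local_fracP f.
have [[p' q'] /= [q'0 gE]] := local_fracP g.
rewrite (residueE q0 fE) (residueE q'0 gE).
have qq'0 : (q * q')@_0%MM != 0 by rewrite mcoeff0M mulf_neq0.
rewrite (@residueE _ (p * p') (q * q')) //.
  by rewrite !mcoeff0M mulf_div.
by rewrite local_valM fE gE !tofracM mulf_div.
Qed.

HB.instance Definition _ := GRing.isZmodMorphism.Build _ _ residue
  residue_is_zmod_morphism.
HB.instance Definition _ := GRing.isMonoidMorphism.Build _ _ residue
  residue_is_monoid_morphism.

Lemma residue_unit f : residue f != 0 -> exists g, g * f = 1.
Proof.
have [[p q] /= [q0 fE]] := local_fracP f.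
rewrite (residueE q0 fE) mulf_eq0 negb_or => /andP[p0 _].
have g_loc : q%:F / p%:F \in @local_pred k n by apply/local_predP; exists q, p.
exists (LocalMPoly g_loc); apply: val_inj => /=.
rewrite [local_val f]fE mulf_div [q%:F * _]mulrC divff //.
by rewrite mulf_neq0 ?tofrac_neq0.
Qed.

Lemma local_maxE f : @local_max k n f <-> residue f = 0.
Proof.
split=> [[p [q [p0 q0 fE]]]|]; first by rewrite (residueE q0 fE) p0 mul0r.
have [[p q] /= [q0 fE]] := local_fracP f; rewrite (residueE q0 fE) => /eqP.
rewrite mulf_eq0 invr_eq0 (negbTE q0) orbF => /eqP p0.
by exists p, q.
Qed.

Lemma to_local_inj : injective (@to_local k n).
Proof. by move=> p q /(congr1 (@local_val k n)) /= /eqP; rewrite tofrac_eq => /eqP. Qed.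

Lemma local_const_is_zmod_morphism : zmod_morphism local_const.
Proof. by move=> x y; rewrite unlock !rmorphB. Qed.

Lemma local_const_is_monoid_morphism : monoid_morphism local_const.
Proof. by split=> [|x y]; rewrite unlock ?rmorph1 // !rmorphM. Qed.

HB.instance Definition _ := GRing.isZmodMorphism.Build _ _ local_const
  local_const_is_zmod_morphism.
HB.instance Definition _ := GRing.isMonoidMorphism.Build _ _ local_const
  local_const_is_monoid_morphism.

Lemma residue_const c : residue (local_const c) = c.
Proof. by rewrite local_const.unlock residue_to_local mcoeffC eqxx mulr1. Qed.

(** Lets a relation with coefficients in the local ring be turned into one between polynomials,
    where coefficients of monomials can be compared. *)
Lemma local_common_denominator (T : eqType) (l : seq T) (c : T -> R) :
  exists q (p : T -> {mpoly k[n]}), q@_0%MM != 0 /\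
    {in l, forall x, to_local q * c x = to_local (p x)}.
Proof.
elim: l => [|y l [q [p [q0 pE]]]].
  by exists 1, (fun=> 0); rewrite mcoeff1 eqxx oner_neq0.
have [[p' q'] /= [q'0 cE]] := local_fracP (c y).
exists (q' * q), (fun x => if x == y then p' * q else q' * p x).
rewrite mcoeff0M mulf_neq0 //; split=> // x; rewrite inE.
case: (eqVneq x y) => [-> _|_ /= /pE xE].
  apply: val_inj; rewrite /= [local_val (c y)]cE !tofracM.
  by rewrite [q'%:F * _]mulrC -mulrA [q'%:F * _]mulrC divfK ?tofrac_neq0 // mulrC.
by rewrite rmorphM -mulrA xE -rmorphM.
Qed.

(** Each monomial of a numerator without constant term has positive degree, hence is divisible by
    some variable and can be charged to it. *)
Lemma residue0_sum f : residue f = 0 ->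
  exists r : 'I_n -> R, f = \sum_i r i * to_local 'X_i.
Proof.
have [[p q] /= [q0 fE]] := local_fracP f; rewrite (residueE q0 fE) => /eqP.
rewrite mulf_eq0 invr_eq0 (negbTE q0) orbF => /eqP p0.
have [r pE] : exists r : 'I_n -> {mpoly k[n]}, p = \sum_i r i * 'X_i.
  have : 0%MM \notin msupp p by rewrite mcoeff_msupp p0 eqxx.
  rewrite [p in exists r, p = _]mpolyE.
  elim: (msupp p) => [|m l IH].
    by exists (fun=> 0); rewrite big_nil big1 // => i _; rewrite mul0r.
  rewrite inE negb_or eq_sym -mdeg_eq0 => /andP[m0 /IH[r rE]].
  have [i mi] : exists i, (0 < m i)%N.
    apply/existsP; move: m0; apply: contraR; rewrite negb_exists => /forallP H.
    by rewrite mdegE big1 // => i _; apply/eqP; rewrite -leqn0 leqNgt H.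
  exists (fun j => (if j == i then p@_m *: 'X_[m - U_(i)] else 0) + r j).
  rewrite big_cons rE; under [RHS]eq_bigr do rewrite mulrDl.
  rewrite big_split /=; congr (_ + _).
  rewrite (bigD1 i) //= eqxx big1 => [|j /negbTE->]; last by rewrite mul0r.
  rewrite addr0 -scalerAl -mpolyXD submK //.
  by apply/mnm_lepP => j; rewrite mnm1E; case: eqP => // <-.
have g_loc : 1%:F / q%:F \in @local_pred k n.
  by apply/local_predP; exists 1, q.
exists (fun i => LocalMPoly g_loc * to_local (r i)).
under eq_bigr do rewrite -mulrA -rmorphM; rewrite -mulr_sumr -rmorph_sum -pE.
by apply: val_inj; rewrite /= [local_val f]fE tofrac1 mul1r mulrC.
Qed.

End ResidueMorphism.

(** * Nakayama's lemma for finitely many elements *)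

Section Nakayama.
Variables (k : fieldType) (n : nat).
Local Notation R := (local_mpoly k n).

Lemma ideal_sum (A : comNzRingType) (J : set A) (T : Type) (l : seq T)
  (P : pred T) (f : T -> A) :
  is_ideal J -> (forall i, P i -> J (f i)) -> J (\sum_(i <- l | P i) f i).
Proof. by move=> [J0 JD _] Jf; apply: (big_ind J). Qed.

(** Determinant trick: with [M] the matrix of the [c i j], the entries of $(1 - M)g$ lie in [J].
    Since [M] vanishes modulo $\mathfrak{m}$, $\det(1 - M)$ has residue 1 and is a unit, so
    multiplying by the adjugate isolates each [g i]. *)
Lemma nakayama (T : finType) (J : set R) (g : T -> R) :
  is_ideal J ->
  (forall i, exists c : T -> R,
     (forall j, residue (c j) = 0) /\ J (g i - \sum_j c j * g j)) ->
  forall i, J (g i).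
Proof.
move=> idJ /choice[c cP] i; have [J0 JD JM] := idJ.
pose M : 'M[R]_#|T| := \matrix_(i, j) c (enum_val i) (enum_val j).
pose v : 'cV[R]_#|T| := \col_i g (enum_val i).
have Jv j : J (((1%:M - M) *m v) j 0).
  rewrite mulmxBl mul1mx !mxE.
  under eq_bigr do rewrite !mxE.
  have [_] := cP (enum_val j); rewrite (reindex (@enum_val T predT)) //=.
  by apply/onW_bij/enum_val_bij.
have /residue_unit[u uP] : residue (\det (1%:M - M)) != 0.
  rewrite -det_map_mx; have -> : map_mx (@residue k n) (1%:M - M) = 1%:M.
    apply/matrixP => a b; rewrite !mxE rmorphB /= (proj1 (cP _)) subr0.
    by rewrite rmorph_nat.
  by rewrite det1 oner_neq0.
have -> : g i = u * (\adj (1%:M - M) *m ((1%:M - M) *m v)) (enum_rank i) 0.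
  by rewrite mulmxA mul_adj_mx mul_scalar_mx !mxE mulrA uP mul1r enum_rankK.
by apply: (JM); rewrite mxE; apply: ideal_sum => // j _; apply: JM.
Qed.

End Nakayama.

(** * Generated ideals, products and powers *)

Section Ideals.
Variable A : comNzRingType.
Implicit Types (I J K : set A).

Lemma ideal_gen_ideal (B : set A) : is_ideal (ideal_gen B).
Proof.
split=> [|_ _ [m [a [f [fB ->]]]] [m' [a' [f' [fB' ->]]]]|h _ [m [a [f [fB ->]]]]].
- by exists 0%N, (fun=> 0), (fun=> 0); rewrite big_ord0; split=> // -[].
- exists (m + m')%N, (fun i => match split i with inl j => a j | inr j => a' j end),
    (fun i => match split i with inl j => f j | inr j => f' j end).
  split=> [i|]; first by case: split.
  rewrite big_split_ord; congr (_ + _); apply: eq_bigr => i _ /=.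
    by have -> : split (lshift m' i) = inl i := unsplitK (inl i).
  by have -> : split (rshift m i) = inr i := unsplitK (inr i).
- exists m, (fun i => h * a i), f; split=> //.
  by rewrite mulr_sumr; apply: eq_bigr => i _; rewrite mulrA.
Qed.

Lemma sub_ideal_gen (B : set A) : B `<=` ideal_gen B.
Proof.
move=> x Bx; exists 1%N, (fun=> 1), (fun=> x).
by rewrite big_ord1 mul1r.
Qed.

Lemma ideal_gen_sub (B J : set A) : is_ideal J -> B `<=` J -> ideal_gen B `<=` J.
Proof.
move=> idJ BJ _ [m [a [f [fB ->]]]]; apply: ideal_sum => // i _.
by have [_ _ JM] := idJ; apply: JM; apply: BJ.
Qed.

Lemma ideal_mul_ideal I J : is_ideal (ideal_mul I J).
Proof. exact: ideal_gen_ideal. Qed.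

Lemma mem_ideal_mul I J a b : I a -> J b -> ideal_mul I J (a * b).
Proof. by move=> Ia Jb; apply: sub_ideal_gen; exists a => //; exists b. Qed.

Lemma ideal_mul_sub I J K : is_ideal K ->
  (forall a b, I a -> J b -> K (a * b)) -> ideal_mul I J `<=` K.
Proof. by move=> idK IJK; apply: ideal_gen_sub => // _ [a Ia [b Jb ->]]; apply: IJK. Qed.

Lemma ideal_mulS I I' J J' :
  I `<=` I' -> J `<=` J' -> ideal_mul I J `<=` ideal_mul I' J'.
Proof.
move=> II' JJ'; apply: ideal_mul_sub; first exact: ideal_mul_ideal.
by move=> a b /II' Ia /JJ' Jb; apply: mem_ideal_mul.
Qed.

Lemma ideal_exp_pow I m f : I f -> ideal_exp I m (f ^+ m).
Proof.
by move=> If; elim: m => [//|m IH]; rewrite exprS; apply: mem_ideal_mul.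
Qed.

Lemma ideal_opp J x : is_ideal J -> J x -> J (- x).
Proof. by move=> [_ _ JM] Jx; rewrite -mulN1r; apply: JM. Qed.

Lemma ideal_sub J x y : is_ideal J -> J x -> J y -> J (x - y).
Proof. by move=> idJ Jx Jy; have [_ JD _] := idJ; apply: JD => //; apply: ideal_opp. Qed.

End Ideals.

Lemma prod_even_odd (A : comNzRingType) (m : nat) (F : nat -> A) :
  \prod_(i < m.*2) F i = \prod_(j < m) F j.*2 * \prod_(j < m) F j.*2.+1.
Proof.
elim: m => [|m IH]; first by rewrite !big_ord0 mulr1.
by rewrite doubleS !big_ord_recr /= IH; ring.
Qed.

(** * Exponent vectors and incidence in a unicyclic graph *)

Section Unicyclic.
(* The graph has the edges {i, t i}; its cycle is z 0, ..., z (2n - 1), and t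
   sends every other vertex to its neighbour on the cycle. *)
Variables (s n : nat) (t : 'I_s -> 'I_s) (z : nat -> 'I_s).
Hypothesis n_gt1 : (1 < n)%N.
Hypothesis zE : forall j, z j = (j %% n.*2)%N :> nat.
Hypothesis tz : forall j, t (z j) = z j.+1.
Hypothesis t_lt : forall i, (t i < n.*2)%N.

Let n_gt0 : (0 < n)%N. Proof. exact: ltnW. Qed.
Let d_gt0 : (0 < n.*2)%N. Proof. by rewrite double_gt0. Qed.

Lemma cycle_ltn j : (z j < n.*2)%N.
Proof. by rewrite zE ltn_pmod. Qed.

Lemma cycle_id (i : 'I_s) : (i < n.*2)%N -> z i = i.
Proof. by move=> lt_i; apply: val_inj; rewrite /= zE modn_small. Qed.

Lemma cycleD j : z (j + n.*2) = z j.
Proof. by apply: val_inj; rewrite /= !zE modnDr. Qed.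

Lemma cycle_inj i j : (i < n.*2)%N -> (j < n.*2)%N -> z i = z j -> i = j.
Proof. by move=> lt_i lt_j /(congr1 val); rewrite /= !zE !modn_small. Qed.

(** The exponent of the monomial in the vertices obtained by multiplying the edges with
    multiplicities [mu]; see [prod_edge]. *)
Definition incidence (mu : 'X_{1..s}) : 'X_{1..s} :=
  (\sum_i (U_(i) + U_(t i)) *+ mu i)%MM.

Lemma incidenceE mu j :
  incidence mu j = (mu j + \sum_(i | t i == j) mu i)%N.
Proof.
rewrite /incidence mnm_sumE; under eq_bigr do rewrite mulmnE mnmDE !mnm1E mulnDl.
rewrite big_split /= (bigD1 j) //= eqxx mul1n big1 ?addn0 => [|i /negbTE->] //.
by congr addn; rewrite [RHS]big_mkcond; apply: eq_bigr => i _; case: eqP;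
  rewrite ?mul1n.
Qed.

Lemma mdeg_incidence mu : mdeg (incidence mu) = (mdeg mu).*2.
Proof.
rewrite /incidence mdeg_sum -mul2n mdegE big_distrr /=; apply: eq_bigr => i _.
by rewrite mdegMn mdegD !mdeg1.
Qed.

Lemma incidence_leaf mu (j : 'I_s) : (n.*2 <= j)%N -> incidence mu j = mu j.
Proof.
move=> le_j; rewrite incidenceE big_pred0 ?addn0 // => i.
by apply: contraTF le_j => /eqP <-; rewrite -ltnNge t_lt.
Qed.

(** A cycle vertex lies on the two cycle edges indexed by itself and by its predecessor, and
    otherwise only on edges to leaves. *)
Lemma incidence_cycle mu j : incidence mu (z j.+1) =
  (mu (z j.+1) + (mu (z j) + \sum_(i | (t i == z j.+1) && (n.*2 <= i)) mu i))%N.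
Proof.
rewrite incidenceE; congr addn; rewrite (bigD1 (z j)) ?tz //=; congr addn.
apply: eq_bigl => i; case: eqP => //= ti; case: leqP => [le_i|lt_i].
  by apply: contraTneq le_i => ->; rewrite -ltnNge cycle_ltn.
apply/negbTE; rewrite negbK; apply/eqP.
move: ti; rewrite -{1 2}(cycle_id lt_i) tz => /(congr1 val) /=; rewrite !zE.
move=> E; apply: val_inj; rewrite /= !zE; move: E.
by rewrite -[i.+1]addn1 -[j.+1]addn1 => /eqP; rewrite eqn_modDr => /eqP.
Qed.

(** * The binomial of the even cycle *)

Section Binomial.
Variables (A : comNzRingType) (al : 'I_s -> A).

Definition evens : A := \prod_(j < n) al (z j.*2).
Definition odds : A := \prod_(j < n) al (z j.*2.+1).

Lemma prod_cycle (f : 'I_s -> A) : \prod_i f i =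
  \prod_(j < n) f (z j.*2) * \prod_(j < n) f (z j.*2.+1) *
  \prod_(i < s | (n.*2 <= i)%N) f i.
Proof.
have le_s : (n.*2 <= s)%N.
  have := ltn_ord (z n.*2.-1); rewrite zE modn_small ?prednK //.
rewrite (bigID (fun i : 'I_s => i < n.*2)%N) /=; congr (_ * _).
  rewrite (big_ord_narrow le_s) -(prod_even_odd n (f \o z)) /=.
  by apply: eq_bigr => i _; congr f; apply: val_inj; rewrite /= zE modn_small.
by apply: eq_bigl => i; rewrite -leqNgt.
Qed.

(* The incidence matrix of a connected graph whose only cycle is even has a
   one-dimensional kernel, spanned by the alternating vector on the cycle. *)
Lemma mmap1_incidence mu nu : incidence mu = incidence nu ->
  exists h, mmap1 al mu - mmap1 al nu = h * (evens - odds).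
Proof.
wlog le0 : mu nu / (nu (z 0) <= mu (z 0))%N.
  move=> W; case: (leqP (nu (z 0)) (mu (z 0))) => [le0|/ltnW le0] E.
    exact: W.
  have [h hE] := W _ _ le0 (esym E).
  by exists (- h); rewrite mulNr -hE opprB.
move=> E; pose dl := (mu (z 0) - nu (z 0))%N.
have leafE (i : 'I_s) : (n.*2 <= i)%N -> mu i = nu i.
  by move=> le_i; rewrite -(incidence_leaf mu le_i) E incidence_leaf.
have stepE j : (mu (z j.+1) + mu (z j) = nu (z j.+1) + nu (z j))%N.
  have := congr1 (fun x : 'X_{1..s} => x (z j.+1)) E.
  rewrite !incidence_cycle => H.
  suff S : (\sum_(i | (t i == z j.+1) && (n.*2 <= i)) mu i =
      \sum_(i | (t i == z j.+1) && (n.*2 <= i)) nu i)%N by lia.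
  by apply: eq_bigr => i /andP[_ /leafE].
(* By [stepE] the difference of [mu] and [nu] changes sign at each step along the cycle, so it is
   [dl] at even and [-dl] at odd positions. *)
have altE j : mu (z j.*2) = (nu (z j.*2) + dl)%N /\
              nu (z j.*2.+1) = (mu (z j.*2.+1) + dl)%N.
  elim: j => [|j [IH1 IH2]]; first by have := stepE 0%N; rewrite double0 /dl; lia.
  rewrite doubleS; have := stepE j.*2.+1; have := stepE j.*2.+2; lia.
rewrite /mmap1 !prod_cycle.
under eq_bigr do rewrite (proj1 (altE _)) exprD.
under [X in _ - _ * X * _]eq_bigr do rewrite (proj2 (altE _)) exprD.
under [X in _ * X - _]eq_bigr => i le_i do rewrite (leafE _ le_i).
rewrite !big_split /= !prodrXl -/evens -/odds.
set a := (\prod_(_ < n) _); set b := (\prod_(_ < n) _); set c := (\prod_(_ < s | _) _).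
(* After extracting the common factors, $\mathrm{evens}^{dl} - \mathrm{odds}^{dl}$ remains, which
   the binomial divides. *)
have := subrXX evens odds dl; set S := (\sum_(_ < _) _) => SE.
exists (a * b * c * S); rewrite -[RHS]mulrA [S * _]mulrC -SE; ring.
Qed.

End Binomial.

(** * Relations among the edges modulo the maximal ideal *)

Section Fiber.
Variable k : fieldType.
Local Notation R := (local_mpoly k s).

Definition edge (i : 'I_s) : R := to_local ('X_i * 'X_(t i)).

Lemma prod_edge (mu : 'X_{1..s}) :
  \prod_i edge i ^+ mu i = to_local 'X_[incidence mu].
Proof.
rewrite /incidence (big_morph (fun m => 'X_[m]) (@mpolyXD _ _) (mpolyX0 _ _)).
rewrite rmorph_prod /=; apply: eq_bigr => i _.
by rewrite -mpolyXn mpolyXD rmorphXn.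
Qed.

(* Presentation of the fiber cone: a relation among the edges becomes, modulo
   the maximal ideal, a multiple of the binomial of the cycle. *)
Lemma fiber_relation (A : comNzRingType) (iota : {rmorphism k -> A})
    (al : 'I_s -> A) (P : {mpoly R[s]}) m :
  P \is m.-homog -> meval edge P = 0 ->
  exists h, mmap (iota \o @residue k s) al P = h * (evens al - odds al).
Proof.
move=> /dhomogP homP; rewrite mevalE => P0.
have [q [p [q0 pE]]] := local_common_denominator (msupp P) (fun mu => P@_mu).
have pX0 : \sum_(mu <- msupp P) p mu * 'X_[incidence mu] = 0.
  apply: to_local_inj; rewrite rmorph0; have := congr1 ( *%R (to_local q)) P0.
  rewrite mulr0 mulr_sumr rmorph_sum => E0; rewrite -[RHS]E0; apply: eq_big_seq => mu mu_P.
  by rewrite [RHS]mulrA pE // prod_edge rmorphM.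
(* All monomials [incidence mu] have the same degree $2m$, so in that degree only the constant
   coefficient of each [p mu] contributes. *)
have coef0 nu :
    \sum_(mu <- msupp P) (incidence mu == nu)%:R * (p mu)@_0%MM = 0.
  have [nuE|nuN] := boolP (nu \in map incidence (msupp P)); last first.
    rewrite big_seq big1 // => mu mu_P; case: eqP => [E|]; last by rewrite mul0r.
    by case/negP: nuN; rewrite -E map_f.
  have dnu : mdeg nu = m.*2.
    by case/mapP: nuE => mu mu_P ->; rewrite mdeg_incidence; congr double; apply: homP.
  have := congr1 (mcoeff nu) pX0; rewrite mcoeff0 raddf_sum /= => E0; rewrite -[RHS]E0.
  apply: eq_big_seq => mu mu_P; case: eqP => [<-|neq].
    by rewrite mul1r -(mcoeffMX (p mu) (incidence mu)) addm0.
  rewrite mul0r mcoeffM big1 //= => -[a b] /=; move: (bmnm a) (bmnm b) => {}a {}b.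
  move=> /eqP nuE'; rewrite mcoeffX; case: eqP => [bE|]; last by rewrite mulr0.
  case: neq; have := congr1 mdeg nuE'.
  rewrite mdegD -bE mdeg_incidence (homP _ mu_P) dnu -[LHS]add0n => /addIn/esym/eqP.
  by rewrite mdeg_eq0 => /eqP a0; rewrite nuE' -bE a0 add0m.
(* One representative is fixed in each fiber of [incidence]; the value 0 is a mere default for the
   empty fibers. *)
have rep_ex nu : exists mu', forall mu, incidence mu = nu -> incidence mu' = nu.
  have [[mu <-]|no] := pselect (exists mu, incidence mu = nu); first by exists mu.
  by exists 0%MM => mu E; case: no; exists mu.
have [rep repP] := choice rep_ex.
have /choice[h hP] mu : exists h, mmap1 al mu - mmap1 al (rep (incidence mu)) =
    h * (evens al - odds al).
  by apply: mmap1_incidence; rewrite (repP _ mu).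
pose G nu := mmap1 al (rep nu).
(* With every monomial replaced by the representative of its fiber, the sum can be grouped by
   fibers, and [coef0] kills each group. *)
have G0 : \sum_(mu <- msupp P) iota (p mu)@_0%MM * G (incidence mu) = 0.
  pose l := undup (map incidence (msupp P)).
  transitivity (\sum_(mu <- msupp P) \sum_(nu <- l)
      iota ((incidence mu == nu)%:R * (p mu)@_0%MM) * G nu).
    apply: eq_big_seq => mu mu_P.
    rewrite (bigD1_seq (incidence mu)) ?undup_uniq ?mem_undup ?map_f //=.
    rewrite eqxx mul1r big1 ?addr0 // => nu /negbTE; rewrite eq_sym => ->.
    by rewrite mul0r rmorph0 mul0r.
  rewrite exchange_big /= big1 // => nu _.
  by rewrite -mulr_suml -rmorph_sum coef0 rmorph0 mul0r.
have q0E mu : mu \in msupp P -> residue P@_mu = (p mu)@_0%MM / q@_0%MM.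
  move=> /pE /(congr1 (@residue k s)); rewrite rmorphM /= !residue_to_local => <-.
  by rewrite mulrC mulKf.
exists (iota (q@_0%MM)^-1 * \sum_(mu <- msupp P) iota (p mu)@_0%MM * h mu).
have := congr1 ( *%R (iota (q@_0%MM)^-1)) G0; rewrite mulr0 => G0'.
rewrite -mulrA mulr_suml -[LHS]subr0 -[X in _ - X]G0'.
rewrite /mmap !mulr_sumr -sumrB; apply: eq_big_seq => mu mu_P /=.
by rewrite q0E // -mulrA -hP rmorphM /G; ring.
Qed.

End Fiber.

(** * Linear forms that vanish on a reduction *)

Section ReductionForms.
Variable k : fieldType.
Local Notation R := (local_mpoly k s).
Implicit Types (J : set R) (c : 'I_s -> R) (a b : 'I_s -> k).

Definition comb c : R := \sum_i c i * edge k i.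

Definition edges_ideal : set R := [set f | exists c, f = comb c].

Lemma combD c c' : comb c + comb c' = comb (fun i => c i + c' i).
Proof. by rewrite /comb -big_split; apply: eq_bigr => i _; rewrite mulrDl. Qed.

Lemma combZ h c : h * comb c = comb (fun i => h * c i).
Proof. by rewrite /comb mulr_sumr; apply: eq_bigr => i _; rewrite mulrA. Qed.

Lemma comb_delta h i : comb (fun j => if j == i then h else 0) = h * edge k i.
Proof.
rewrite /comb (bigD1 i) //= eqxx big1 ?addr0 // => j /negbTE->.
by rewrite mul0r.
Qed.

Lemma comb0 : comb (fun=> 0) = 0.
Proof. by rewrite /comb big1 // => i _; rewrite mul0r. Qed.

Lemma edges_ideal_ideal : is_ideal edges_ideal.
Proof.
split=> [|_ _ [c ->] [c' ->]|h _ [c ->]].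
- by exists (fun=> 0); rewrite comb0.
- by rewrite combD; eexists.
- by rewrite combZ; eexists.
Qed.

Lemma edges_ideal_edge i : edges_ideal (edge k i).
Proof. by rewrite -[edge k i]mul1r -comb_delta; eexists. Qed.

Section Evaluation.
Variables (A : comNzRingType) (iota : {rmorphism k -> A}) (al : 'I_s -> A).

(** The class of [comb c] in $I/\mathfrak{m}I = k^s$, evaluated at the point [al]. The ring [A] is
    $k$ for a single form and $k[t]$ for a pencil of forms. *)
Definition symbol c : A := \sum_i iota (residue (c i)) * al i.

Definition linear_form c : {mpoly R[s]} := \sum_i c i *: 'X_i.

Lemma linear_form_homog c : linear_form c \is 1.-homog.
Proof. by apply: rpred_sum => i _; rewrite rpredZ // dhomogX /= mdeg1. Qed.

Lemma meval_linear_form c : meval (edge k) (linear_form c) = comb c.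
Proof.
rewrite /linear_form rmorph_sum /comb; apply: eq_bigr => i _ /=.
by rewrite mevalZ mevalXU.
Qed.

Lemma mmap_linear_form c :
  mmap (iota \o @residue k s) al (linear_form c) = symbol c.
Proof.
rewrite /linear_form raddf_sum /symbol; apply: eq_bigr => i _ /=.
by rewrite mmapZ mmapX mmap1U.
Qed.

Lemma edges_ideal_exp_form m : ideal_exp edges_ideal m `<=`
  [set f | exists2 P : {mpoly R[s]}, P \is m.-homog & f = meval (edge k) P].
Proof.
elim: m => [|m IH].
  move=> f _; exists f%:MP; last by rewrite mevalC.
  by rewrite -[f%:MP]mulr1 mul_mpolyC rpredZ // dhomog1.
apply: ideal_mul_sub => [|_ g [c ->] /IH[P homP ->]]; last first.
  exists (linear_form c * P); first exact: (dhomogM (linear_form_homog c) homP).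
  by rewrite mevalM meval_linear_form.
split=> [|_ _ [P homP ->] [Q homQ ->]|h _ [P homP ->]].
- by exists 0; rewrite ?rpred0 ?meval0.
- by exists (P + Q); rewrite ?rpredD ?mevalD.
- by exists (h *: P); rewrite ?rpredZ ?mevalZ.
Qed.

(** The power of [comb c] lies in $I^{r+1} = JI^r$, so it also equals a form [P] in the edges that
    vanishes at [al]. Subtracting [P] from the power of the linear form gives a relation, to which
    [fiber_relation] applies. *)
Lemma reduction_symbol J c : reduction J edges_ideal ->
  (forall c', J (comb c') -> symbol c' = 0) ->
  exists r h, symbol c ^+ r.+1 = h * (evens al - odds al).
Proof.
move=> [idJ JI [r rE]] J0; exists r.
have JIr : ideal_mul J (ideal_exp edges_ideal r) `<=`
    [set f | exists P : {mpoly R[s]}, [/\ P \is r.+1.-homog,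
      f = meval (edge k) P & mmap (iota \o @residue k s) al P = 0]].
  apply: ideal_mul_sub => [|f g Jf /edges_ideal_exp_form[P homP ->]]; last first.
    have [c' fE] := JI _ Jf; rewrite fE in Jf *.
    exists (linear_form c' * P); split.
    + exact: (dhomogM (linear_form_homog c') homP).
    + by rewrite mevalM meval_linear_form.
    + by rewrite rmorphM /= mmap_linear_form J0 // mul0r.
  split=> [|_ _ [P [homP -> P0]] [Q [homQ -> Q0]]|h _ [P [homP -> P0]]].
  - by exists 0; rewrite rpred0 meval0 raddf0.
  - by exists (P + Q); rewrite rpredD // mevalD raddfD /= P0 Q0 addr0.
  - by exists (h *: P); rewrite rpredZ // mevalZ mmapZ P0 mulr0.
have /JIr[P [homP cE P0]] : ideal_mul J (ideal_exp edges_ideal r) (comb c ^+ r.+1).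
  by rewrite -rE; apply: ideal_exp_pow; exists c.
have homQ : linear_form c ^+ r.+1 - P \is r.+1.-homog.
  by rewrite rpredB //; have := dhomogMn r.+1 (linear_form_homog c); rewrite mul1n.
have [|h hE] := fiber_relation iota al homQ.
  by rewrite mevalB rmorphXn /= meval_linear_form cE subrr.
by exists h; rewrite -hE raddfB /= P0 subr0 rmorphXn /= mmap_linear_form.
Qed.

End Evaluation.

Definition annihilates b J := forall c, J (comb c) -> symbol idfun b c = 0.

Lemma annihilator_binomial J b i : reduction J edges_ideal ->
  annihilates b J -> b i != 0 -> evens b - odds b != 0.
Proof.
move=> redJ bJ bi.
have [r [h]] := reduction_symbol (fun j => if j == i then 1 else 0) redJ bJ.
have -> : symbol idfun b (fun j => if j == i then 1 else 0) = b i.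
  rewrite /symbol (bigD1 i) //= eqxx rmorph1 mul1r big1 ?addr0 // => j /negbTE->.
  by rewrite rmorph0 mul0r.
move=> E; apply: contraNneq bi => F0; have : b i ^+ r.+1 == 0 by rewrite E F0 mulr0.
by rewrite expf_eq0.
Qed.

Lemma prod_linear_poly (m : nat) (f g : nat -> k) :
  (\prod_(j < m) ((f j)%:P + g j *: 'X))`_m = \prod_(j < m) g j.
Proof.
suff [] : (size (\prod_(j < m) ((f j)%:P + g j *: 'X))%R <= m.+1)%N /\
    (\prod_(j < m) ((f j)%:P + g j *: 'X))`_m = \prod_(j < m) g j by [].
elim: m => [|m [sz cf]]; first by rewrite !big_ord0 size_poly1 coef1.
rewrite !big_ord_recr /=; split.
  apply: leq_trans (size_polyMleq _ _) _.
  have : (size ((f m)%:P + g m *: 'X)%R <= 2)%N.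
    rewrite (leq_trans (size_polyD _ _)) // geq_max (leq_trans (size_polyC_leq1 _)) //.
    by rewrite (leq_trans (size_scale_leq _ _)) ?size_polyX.
  by move/(leq_add sz); rewrite addn2; case: (_ + _)%N.
rewrite mulrDr coefD coefMC -scalerAr coefZ coefMX /= cf.
by rewrite (nth_default _ sz) mul0r add0r mulrC.
Qed.

(* With two independent annihilators a and b, the binomial form restricted to
   the pencil a + t b would divide a nonzero constant; but its coefficient at
   t ^ n is its value at b. *)
Lemma annihilator_line J a b i0 i1 : reduction J edges_ideal ->
  annihilates a J -> annihilates b J -> b i0 != 0 -> a i0 = 0 -> a i1 = 0.
Proof.
move=> redJ aJ bJ bi0 ai0; apply/eqP; apply: contraT => ai1.
pose al i : {poly k} := (a i)%:P + b i *: 'X.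
have symE c : symbol polyC al c =
    (symbol idfun a c)%:P + symbol idfun b c *: 'X.
  rewrite /symbol rmorph_sum scaler_suml -big_split; apply: eq_bigr => i _ /=.
  move: (residue (c i)) => x.
  by rewrite /al mulrDr polyCM !mul_polyC scalerA.
have i10 : i1 != i0 by apply: contraNneq ai1 => ->; rewrite ai0.
(* This represents $e_{i_1} - (b_{i_1}/b_{i_0})e_{i_0}$: [b] vanishes on it while [a] takes the
   value [a i1], so its symbol on the pencil is a nonzero constant. *)
pose c i : R := if i == i1 then 1 else
  if i == i0 then local_const s (- (b i1 / b i0)) else 0.
have sumE (f : 'I_s -> k) : symbol idfun f c = f i1 - b i1 / b i0 * f i0.
  rewrite /symbol (bigD1 i1) //= (bigD1 i0) /=; last by rewrite eq_sym.
  rewrite /c eqxx rmorph1 mul1r eq_sym (negbTE i10) eqxx residue_const mulNr.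
  rewrite big1 ?addr0 // => i /andP[/negbTE-> /negbTE->].
  by rewrite rmorph0 mul0r.
have [|r [h]] := @reduction_symbol _ polyC al J c redJ.
  by move=> c' Jc'; rewrite symE aJ // bJ // scale0r addr0.
rewrite symE !sumE ai0 mulr0 subr0 divfK // subrr scale0r addr0 => E.
set D := evens al - odds al in E.
have Dn : D`_n != 0.
  rewrite /D coefB /evens /odds.
  rewrite (prod_linear_poly n (fun j => a (z j.*2)) (fun j => b (z j.*2))).
  rewrite (prod_linear_poly n (fun j => a (z j.*2.+1)) (fun j => b (z j.*2.+1))).
  exact: annihilator_binomial redJ bJ bi0.
have szD : (n < size D)%N by rewrite ltnNge; apply: contra Dn => /leq_sizeP->.
have D0 : D != 0 by apply: contraNneq Dn => ->; rewrite coef0.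
have E0 : h * D != 0 by rewrite -E expf_neq0 // polyC_eq0.
have h0 : h != 0 by apply: contraNneq E0 => ->; rewrite mul0r.
have := congr1 (size : {poly k} -> nat) E.
rewrite -rmorphXn /= size_polyC expf_neq0 // size_mul //.
have : (0 < size h)%N by rewrite size_poly_gt0.
by move: szD; move: (size h) (size D) => x y /=; move: n_gt0; clear; lia.
Qed.

(** A matrix of maximal rank with row space inside [W] exhausts [W], since adjoining a missing
    vector would raise the rank. *)
Lemma subspace_row_space (W : 'rV[k]_s -> Prop) :
  W 0 -> (forall u v, W u -> W v -> W (u + v)) ->
  (forall x v, W v -> W (x *: v)) ->
  exists B : 'M[k]_s, forall v, W v <-> (v <= B)%MS.
Proof.
move=> W0 WD WZ.
pose Q r := `[< exists B : 'M[k]_s, (forall v, (v <= B)%MS -> W v) /\ \rank B = r >].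
have exQ : exists r, Q r.
  exists 0%N; apply/asboolP; exists 0; rewrite mxrank0; split=> // v.
  by rewrite submx0 => /eqP->.
have ubQ r : Q r -> (r <= s)%N.
  by move=> /asboolP[B [_ <-]]; apply: rank_leq_row.
case: (ex_maxnP exQ ubQ) => r /asboolP[B [BW rB]] rmax; exists B => v.
split=> [Wv|/BW //]; apply: contraT => vB.
have /rmax : Q (\rank (B + v)%MS).
  apply/asboolP; exists (B + v)%MS; split=> // w /sub_addsmxP[[x y] /= ->].
  apply: WD; first by apply: BW; apply: submxMl.
  by rewrite [y]mx11_scalar mul_scalar_mx; apply: WZ.
rewrite -rB leqNgt => /negP[]; rewrite ltn_neqAle mxrankS ?addsmxSl // andbT.
apply: contra vB => /eqP rE.
have [_ E] := mxrank_leqif_eq (addsmxSl B v).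
have /andP[_ sB] : (B == B + v)%MS by rewrite -E rE.
by apply: submx_trans sB; apply: addsmxSr.
Qed.

Definition lifts (J : set R) (v : 'I_s -> k) :=
  exists2 c, J (comb c) & forall i, residue (c i) = v i.

(** The image of [J] in $k^s$ is the row space of [B], and [K] is the space of forms vanishing on
    it. By [annihilator_line], [K] is spanned by at most one form, whose kernel is the image of [J]
    by biduality. *)
Lemma reduction_hyperplane J : reduction J edges_ideal ->
  exists a, evens a - odds a != 0 /\
    forall v : 'I_s -> k, \sum_i v i * a i = 0 -> lifts J v.
Proof.
move=> redJ; have [[J0 JD JM] _ _] := redJ.
have [|u v [c Jc cu] [c' Jc' cv]|x v [c Jc cv]|B BP] :=
    @subspace_row_space (fun v => lifts J (v 0)).
- by exists (fun=> 0); rewrite ?comb0 // => i; rewrite rmorph0 mxE.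
- exists (fun i => c i + c' i); first by rewrite -combD; apply: JD.
  by move=> i; rewrite rmorphD /= cu cv mxE.
- exists (fun i => local_const s x * c i); first by rewrite -combZ; apply: JM.
  by move=> i; rewrite rmorphM /= residue_const cv mxE.
have dotE (u v : 'rV[k]_s) : u *m v^T = (\sum_i u 0 i * v 0 i)%:M.
  apply/matrixP => i j; rewrite !ord1 !mxE mulr1n.
  by apply: eq_bigr => l _; rewrite !mxE.
pose K := kermx B^T.
have KJ (u : 'rV[k]_s) : (u <= K)%MS -> annihilates (u 0) J.
  move=> /sub_kermxP uB c Jc; pose w : 'rV[k]_s := \row_i residue (c i).
  have /BP /submxP[D wE] : lifts J (w 0) by exists c => // i; rewrite mxE.
  have : w *m u^T = 0 by rewrite wE -mulmxA -[B]trmxK -trmx_mul uB trmx0 mulmx0.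
  rewrite dotE => /matrixP/(_ 0 0); rewrite !mxE mulr1n => <-.
  by apply: eq_bigr => i _; rewrite mxE.
have KB (v : 'rV[k]_s) : v *m K^T = 0 -> lifts J (v 0).
  move=> vK; apply/BP.
  (* Biduality: [B] lies in the orthogonal of its orthogonal, and the ranks agree. *)
  have BK : (B <= kermx K^T)%MS.
    by apply/sub_kermxP; rewrite -[B]trmxK -trmx_mul mulmx_ker trmx0.
  have rE : \rank B = \rank (kermx K^T).
    by rewrite mxrank_ker mxrank_tr mxrank_ker mxrank_tr subKn // rank_leq_row.
  have [_ E] := mxrank_leqif_eq BK.
  have /andP[_ sB] : (B == kermx K^T)%MS by rewrite -E rE.
  by apply: submx_trans sB; apply/sub_kermxP.
have [K0|/rowV0Pn[b bK b0]] := eqVneq K 0.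
  (* Here [J] maps onto all of $k^s$, so any form with nonzero binomial will do; this one has
     [evens] equal to 1 and [odds] equal to 0. *)
  exists (fun i : 'I_s => (~~ odd i)%:R); split=> [|v _]; last first.
    by have := KB (\row_i v i); rewrite K0 trmx0 mulmx0 => -[//|c Jc cv];
       exists c => // i; rewrite cv mxE.
  rewrite /evens /odds big1 => [|j _].
    case: n n_gt0 zE => [//|m] _ zE'; rewrite big_ord_recl /=.
    by rewrite zE' odd_mod ?odd_double //= mul0r subr0 oner_neq0.
  by rewrite zE odd_mod ?odd_double.
have /existsP[i0 bi0] : [exists i, b 0 i != 0].
  apply: contraNT b0; rewrite negb_exists => /forallP b0.
  by apply/eqP/rowP => i; have := b0 i; rewrite negbK mxE => /eqP.
exists (b 0); split; first exact: annihilator_binomial redJ (KJ _ bK) bi0.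
move=> v vb; suff : lifts J ((\row_i v i) 0 : 'I_s -> k).
  by move=> [c Jc cv]; exists c => // i; rewrite cv mxE.
apply: KB; suff /submxP[D ->] : (K <= b)%MS.
  rewrite trmx_mul mulmxA dotE.
  by under eq_bigr do rewrite mxE; rewrite vb raddf0 mul0mx.
(* The multiple of [b] is chosen to cancel coordinate [i0]; [annihilator_line] then makes all
   coordinates of the difference vanish. *)
apply/rV_subP => u uK; pose x := u 0 i0 / b 0 i0.
suff -> : u = x *: b by apply: scalemx_sub.
apply/rowP => i; apply/eqP; rewrite -subr_eq0; apply/eqP.
have uxK : (u - x *: b <= K)%MS by rewrite addmx_sub // eqmx_opp scalemx_sub.
have := annihilator_line i redJ (KJ _ uxK) (KJ _ bK) bi0.
by rewrite !mxE; apply; rewrite /x divfK // subrr.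
Qed.

End ReductionForms.

(** * Containment of $\mathfrak{m}I$ in every reduction *)

Section Core.
Variable k : fieldType.
Local Notation R := (local_mpoly k s).
Local Notation I := (@edges_ideal k).
Local Notation e := (edge k).
Local Notation x_ i := (to_local ('X_i : {mpoly k[s]})).
Implicit Types (J : set R) (c : 'I_s -> R) (a : 'I_s -> k).

Lemma binomial_neq0 a : evens a - odds a != 0 -> exists i, a i != 0.
Proof.
move=> Fa; apply: contrapT => no; have a0 i : a i = 0.
  by apply/eqP; apply: contraT => ai; case: no; exists i.
move: Fa; rewrite /evens /odds; case: n n_gt0 => [//|m] _.
by rewrite !big_ord_recl !a0 !mul0r subrr eqxx.
Qed.

(** Moving the start by two only permutes the factors cyclically, so the product depends on the
    parity of [j] alone. *)
Lemma cycle_walk a j :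
  \prod_(l < n) a (z (j + l.*2)) = if odd j then odds a else evens a.
Proof.
pose P j := \prod_(l < n) a (z (j + l.*2)).
suff [] : P j = (if odd j then odds a else evens a) /\
    P j.+1 = (if odd j.+1 then odds a else evens a) by [].
have PS i : P i.+2 = P i.
  rewrite /P; have E l : a (z (i.+2 + l.*2)) = a (z (i + l.+1.*2)).
    by rewrite doubleS !addnS !addSn.
  under eq_bigr do rewrite E.
  case: n n_gt0 cycleD => [//|m] _ zD.
  by rewrite big_ord_recr big_ord_recl /= zD mulrC double0 addn0.
elim: j => [|j [IH1 IH2]]; last by rewrite PS IH1 /= negbK.
by split; apply: eq_bigr => l _; rewrite ?add0n ?add1n.
Qed.

(* Modulo N = J + m^2 I every edge e_i is a multiple a_i g of a single element
   g; walking around the cycle with x_{i+2} e_i = x_i e_{i+1} multiplies x_i g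
   by the two products of the cycle binomial, which differ. *)
Lemma reduction_variable_edge J : reduction J I -> forall i j, J (x_ i * e j).
Proof.
move=> redJ; have [idJ _ _] := redJ; have [J0 JD JM] := idJ.
have [a [Fa liftJ]] := reduction_hyperplane redJ.
pose gen (p : 'I_s * 'I_s) : R := x_ p.1 * e p.2.
(* The second summand $\mathfrak{m}^2I$ is written as combinations of the generators $x_ie_j$ of
   $\mathfrak{m}I$ with coefficients in $\mathfrak{m}$, the shape that [nakayama] expects. *)
pose N : set R := [set f | exists M : 'I_s * 'I_s -> R,
  (forall p, residue (M p) = 0) /\ J (f - \sum_p M p * gen p)].
have idN : is_ideal N.
  split=> [|f g [M [M0 JMf]] [M' [M'0 JMg]]|h f [M [M0 JMf]]].
  - exists (fun=> 0); split=> [p|]; first by rewrite rmorph0.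
    by rewrite big1 ?subrr // => p _; rewrite mul0r.
  - exists (fun p => M p + M' p); split=> [p|].
      by rewrite rmorphD /= M0 M'0 addr0.
    under eq_bigr do rewrite mulrDl; rewrite big_split /= opprD addrACA.
    exact: JD.
  - exists (fun p => h * M p); split=> [p|]; first by rewrite rmorphM /= M0 mulr0.
    under eq_bigr do rewrite -mulrA; rewrite -mulr_sumr -mulrBr.
    exact: JM.
have [N0 ND NM] := idN.
have JN f : J f -> N f.
  move=> Jf; exists (fun=> 0); split=> [p|]; first by rewrite rmorph0.
  by rewrite big1 ?subr0 // => p _; rewrite mul0r.
have mN h i j : residue h = 0 -> N (h * (x_ i * e j)).
  move=> h0; exists (fun p => if p == (i, j) then h else 0).
  split=> [p|]; first by case: ifP => _; rewrite ?rmorph0.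
  rewrite (bigD1 (i, j)) //= eqxx big1 => [|p /negbTE->]; last by rewrite mul0r.
  by rewrite addr0 subrr.
(* Replacing the coefficients of a lift in [J] by their residues costs an element of
   $\mathfrak{m}I$, hence one of $\mathfrak{m}^2I$ after multiplication by a variable. *)
have liftN v i : \sum_j v j * a j = 0 -> N (x_ i * comb (fun j => local_const s (v j))).
  move=> /liftJ[c Jc cv].
  have -> : x_ i * comb (fun j => local_const s (v j)) =
      x_ i * comb c + \sum_j (local_const s (v j) - c j) * (x_ i * e j).
    rewrite /comb !mulr_sumr -big_split; apply: eq_bigr => j _ /=.
    by rewrite mulrBl addrC (mulrCA (c j)) subrK mulrCA.
  apply: ND; first by apply: JN; apply: JM.
  apply: ideal_sum => // j _; apply: mN.
  by rewrite rmorphB /= residue_const cv subrr.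
have constN x f : x != 0 -> N (local_const s x * f) -> N f.
  move=> x0 Nxf; have -> : f = local_const s x^-1 * (local_const s x * f); last exact: NM.
  by rewrite mulrA -rmorphM mulVf // rmorph1 mul1r.
have [i0 ai0] := binomial_neq0 Fa.
pose g := local_const s (a i0)^-1 * e i0; pose y i := x_ i * g.
have eN i j : N (x_ i * e j - local_const s (a j) * y i).
  (* The vector of $e_j - a_jg$, on which [a] vanishes. *)
  pose v l : k := (l == j)%:R - (a j / a i0) * (l == i0)%:R.
  have deltaE (A : comNzRingType) (l : 'I_s) (f : 'I_s -> A) :
      \sum_m (m == l)%:R * f m = f l.
    rewrite (bigD1 l) //= eqxx mul1r big1 ?addr0 // => m /negbTE->.
    by rewrite mul0r.
  have := liftN v i; rewrite /comb.
  have -> : \sum_l local_const s (v l) * e l = e j - local_const s (a j) * g.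
    have vE l : local_const s (v l) * e l = (l == j)%:R * e l -
        local_const s (a j / a i0) * ((l == i0)%:R * e l).
      by rewrite /v rmorphB [X in _ - X]rmorphM !rmorph_nat mulrBl mulrA.
    under eq_bigr do rewrite vE.
    by rewrite sumrB -mulr_sumr !deltaE rmorphM -mulrA.
  rewrite mulrBr /y mulrCA; apply.
  have vE l : v l * a l = (l == j)%:R * a l - a j / a i0 * ((l == i0)%:R * a l).
    by rewrite /v mulrBl !mulrA.
  by under eq_bigr do rewrite vE; rewrite sumrB -mulr_sumr !deltaE divfK ?subrr.
have swapN i j i' j' : x_ i * e j = x_ i' * e j' ->
    N (local_const s (a j) * y i - local_const s (a j') * y i').
  move=> E; have := ideal_sub idN (eN i' j') (eN i j).
  by rewrite E opprB addrC addrA subrK.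
have edgeE i : e i = x_ i * x_ (t i) by rewrite /edge rmorphM.
have stepN i : N (local_const s (a i) * y (t (t i)) - local_const s (a (t i)) * y i).
  by apply: swapN; rewrite !edgeE mulrC -mulrA.
have walkN j m : N (local_const s (\prod_(l < m) a (z (j + l.*2))) * y (z (j + m.*2)) -
    local_const s (\prod_(l < m) a (z (j.+1 + l.*2))) * y (z j)).
  elim: m => [|m IH].
    by rewrite !big_ord0 double0 addn0 subrr.
  rewrite !big_ord_recr /= !rmorphM /=.
  have := ND _ _ (NM (local_const s (\prod_(l < m) a (z (j + l.*2)))) _ (stepN (z (j + m.*2))))
    (NM (local_const s (a (z (j.+1 + m.*2)))) _ IH).
  have E (A : comNzRingType) (p p' u v y0 y1 y2 : A) :
      p * (u * y2 - v * y1) + v * (p * y1 - p' * y0) = p * u * y2 - p' * v * y0 by ring.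
  by rewrite !tz addSn doubleS !addnS E.
(* After [n] double steps the walk is back at [z j], so [y (z j)] gets multiplied by the cycle
   binomial at [a] up to sign, a nonzero constant. *)
have cycleN j : N (y (z j)).
  have := walkN j n; rewrite cycleD -mulrBl -rmorphB !cycle_walk /=; apply: constN.
  by case: (odd j) => //=; rewrite -oppr_eq0 opprB.
have yN i : N (y i).
  have [lt_i|le_i] := ltnP i n.*2; first by rewrite -(cycle_id lt_i).
  (* For a leaf, the edge is compared with each of the two cycle edges at its neighbour. It suffices
     that [a] is nonzero on one of them; were it zero on both, [evens a] and [odds a] would both
     vanish. *)
  have [j tiE] : exists j, t i = z j.+1.
    exists (t i + n.*2.-1)%N; rewrite -addnS prednK // cycleD.
    by rewrite cycle_id.
  have [aj|aj] := eqVneq (a (z j)) 0; last first.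
    apply: (constN (a (z j))) => //.
    have E : x_ i * e (z j) = x_ (z j) * e i by rewrite !edgeE tz tiE mulrCA.
    have := ND _ _ (swapN _ _ _ _ E) (NM (local_const s (a i)) _ (cycleN j)).
    by rewrite subrK.
  apply: (constN (a (z j.+1))); last first.
    have := ideal_sub idN (NM (local_const s (a i)) _ (cycleN j.+2)) (stepN i).
    by rewrite tiE tz subKr.
  apply: contraNneq Fa => aj1.
  have P0 l : a (z l) = 0 -> \prod_(m < n) a (z (l + m.*2)) = 0.
    case: n n_gt0 => [//|m] _ al; rewrite big_ord_recl /= double0 addn0 al.
    by rewrite mul0r.
  have := P0 _ aj; have := P0 _ aj1; rewrite !cycle_walk /=.
  by case: (odd j) => /= -> ->; rewrite subrr.
have genN p : N (gen p).
  rewrite /gen -[_ * _](subrK (local_const s (a p.2) * y p.1)).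
  by apply: ND; [apply: eN | apply: NM; apply: yN].
by move=> i j; apply: (nakayama (g := gen) idJ genN (i, j)).
Qed.

Lemma reduction_sup J : reduction J I -> ideal_mul (@local_max k s) I `<=` J.
Proof.
move=> redJ; have [idJ _ _] := redJ; have [_ _ JM] := idJ.
apply: ideal_mul_sub => // h _ /local_maxE/residue0_sum[r ->] [c ->].
rewrite mulr_suml; apply: ideal_sum => // i _.
rewrite /comb mulr_sumr; apply: ideal_sum => // j _.
have -> : r i * x_ i * (c j * e j) = r i * c j * (x_ i * e j) by rewrite mulrACA.
by apply: (JM); apply: reduction_variable_edge.
Qed.

(** * Hyperplanes of $I/\mathfrak{m}I$ as reductions *)

Definition hyperplane a : set R :=
  [set f | exists2 c, f = comb c & symbol idfun a c = 0].

Lemma hyperplane_ideal a : is_ideal (hyperplane a).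
Proof.
split=> [|_ _ [c -> c0] [c' -> c'0]|h _ [c -> c0]].
- exists (fun=> 0); first by rewrite comb0.
  by rewrite /symbol big1 // => i _; rewrite rmorph0 mul0r.
- rewrite combD; eexists; first by [].
  rewrite /symbol; under eq_bigr do rewrite rmorphD /= mulrDl.
  by rewrite big_split /= [X in X + _]c0 [X in _ + X]c'0 addr0.
- rewrite combZ; eexists; first by [].
  rewrite /symbol; under eq_bigr do rewrite rmorphM /= -mulrA.
  by rewrite -mulr_sumr [X in _ * X]c0 mulr0.
Qed.

Lemma hyperplane_sub a : hyperplane a `<=` I.
Proof. by move=> _ [c -> _]; exists c. Qed.

(** As [n] is at least 2, the product has the distinct indices [z 0] and [z 2] among its factors,
    and [i] can equal only one of them. *)
Lemma evens_delta (A : comNzRingType) i :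
  evens (fun j => (j == i)%:R : A) = 0.
Proof.
rewrite /evens; case: n n_gt1 (@cycle_inj) => [//|[//|m]] _ zI.
rewrite !big_ord_recl /=; case: eqP => [E|]; last by rewrite mul0r.
case: eqP => [E'|]; last by rewrite mul0r mulr0.
by have := zI 0%N 2%N isT isT; rewrite [in LHS]E => /(_ (esym E')).
Qed.

Lemma odds_delta (A : comNzRingType) i :
  odds (fun j => (j == i)%:R : A) = 0.
Proof.
rewrite /odds; case: n n_gt1 (@cycle_inj) => [//|[//|m]] _ zI.
rewrite !big_ord_recl /=; case: eqP => [E|]; last by rewrite mul0r.
case: eqP => [E'|]; last by rewrite mul0r mulr0.
by have := zI 1%N 3%N isT isT; rewrite [in LHS]E => /(_ (esym E')).
Qed.

Lemma symbol_delta c i :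
  symbol idfun (fun j => (j == i)%:R : k) c = residue (c i).
Proof.
rewrite /symbol (bigD1 i) //= eqxx mulr1 big1 ?addr0 // => j /negbTE->.
by rewrite mulr0.
Qed.

(** The edges are linearly independent modulo $\mathfrak{m}I$: the difference is a linear relation,
    and evaluating it at the [i]-th unit vector, where the cycle binomial vanishes, gives its
    coefficient at [i]. *)
Lemma residue_comb_eq c c' i : comb c = comb c' -> residue (c i) = residue (c' i).
Proof.
move=> E; apply/eqP; rewrite -subr_eq0 -rmorphB /=.
pose b j := c j - c' j; rewrite -[c i - c' i]/(b i) -symbol_delta.
rewrite -mmap_linear_form.
have [|h ->] := fiber_relation idfun (fun j => (j == i)%:R) (linear_form_homog b).
  rewrite meval_linear_form /comb /b; under eq_bigr do rewrite mulrBl.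
  by rewrite sumrB -/(comb c) E subrr.
by rewrite evens_delta odds_delta subrr mulr0.
Qed.

Lemma hyperplane_comb a c : hyperplane a (comb c) -> symbol idfun a c = 0.
Proof.
move=> [c' E <-]; apply: eq_bigr => i _.
by rewrite (residue_comb_eq i E).
Qed.

(** Both perfect matchings of the cycle multiply to the product of all cycle vertices. *)
Lemma prod_edges_evens : evens e = odds e.
Proof.
have E i : e i = x_ i * x_ (t i) by rewrite /edge rmorphM.
rewrite /evens /odds; under eq_bigr do rewrite E tz.
under [RHS]eq_bigr do rewrite E tz.
rewrite !big_split /= mulrC; congr (_ * _).
have := cycleD 0; rewrite add0n; case: n n_gt0 => [//|m] _ zD.
by rewrite big_ord_recl [RHS]big_ord_recr /= mulrC -doubleS zD.
Qed.

(* Modulo the hyperplane every edge e_i is a multiple a_i g of one element g,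
   so that e_1 e_3 ... = e_2 e_4 ... forces g ^ n into the product. *)
Lemma hyperplane_reduction a : evens a - odds a != 0 -> reduction (hyperplane a) I.
Proof.
move=> Fa; have idH := hyperplane_ideal a.
split=> //; first exact: hyperplane_sub.
have [i0 ai0] := binomial_neq0 Fa.
pose g := local_const s (a i0)^-1 * e i0.
have Ig : I g by have [_ _ IM] := edges_ideal_ideal k; apply/IM/edges_ideal_edge.
have combH c : hyperplane a (comb c - local_const s (symbol idfun a c) * g).
  pose w := local_const s (symbol idfun a c / a i0).
  exists (fun j => c j - (if j == i0 then w else 0)).
    rewrite /comb; under [RHS]eq_bigr do rewrite mulrBl.
    rewrite sumrB -/(comb (fun j => if j == i0 then w else 0)) comb_delta.
    by rewrite /g /w rmorphM mulrA.
  rewrite /symbol; under eq_bigr do rewrite rmorphB /= mulrBl.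
  rewrite sumrB [X in _ - X](bigD1 i0) //= eqxx residue_const divfK //.
  rewrite [X in _ - (_ + X)]big1 ?addr0 ?subrr //.
  by move=> i /negbTE->; rewrite rmorph0 mul0r.
have edgeH i : hyperplane a (e i - local_const s (a i) * g).
  have := combH (fun j => if j == i then 1 else 0).
  rewrite comb_delta mul1r; congr (hyperplane a (_ - local_const s _ * _)).
  rewrite /symbol (bigD1 i) //= eqxx rmorph1 mul1r big1 ?addr0 // => j /negbTE->.
  by rewrite rmorph0 mul0r.
have telescope (A : comNzRingType) (x u y w f v : A) :
    (x - u * y) * f + u * (y * (f - w * v)) = x * f - u * w * (y * v) by ring.
pose HI m := ideal_mul (hyperplane a) (ideal_exp I m).
have idHI m : is_ideal (HI m) by apply: ideal_mul_ideal.
have HIS m f h : I h -> HI m f -> HI m.+1 (h * f).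
  move=> Ih; suff : HI m `<=` [set f | HI m.+1 (h * f)] by apply.
  apply: ideal_mul_sub.
    have [H0 HD HM] := idHI m.+1.
    split=> [|x y|x y] /=; first by rewrite mulr0.
      by rewrite mulrDr; apply: HD.
    by move=> Hy; rewrite mulrCA; apply: HM.
  move=> x y Hx Iy /=; rewrite mulrCA; apply: mem_ideal_mul => //.
  exact: mem_ideal_mul.
have idK m : is_ideal [set f | exists w, HI m (f - w * g ^+ m.+1)].
  have [H0 HD HM] := idHI m.
  split=> [|f f' [w Hw] [w' Hw']|h f [w Hw]].
  - by exists 0; rewrite mul0r subrr.
  - by exists (w + w'); rewrite mulrDl opprD addrACA; apply: HD.
  - by exists (h * w); rewrite -mulrA -mulrBr; apply: HM.
(* Modulo $HI^m$, with $H$ the hyperplane, the power $I^{m+1}$ is generated by $g^{m+1}$; factors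
   are replaced by multiples of [g] one at a time via [telescope]. *)
have expH m : ideal_exp I m.+1 `<=` [set f | exists w, HI m (f - w * g ^+ m.+1)].
  elim: m => [|m IH]; apply: ideal_mul_sub => // _ f [c ->] If.
    exists (local_const s (symbol idfun a c) * f).
    by rewrite expr1 mulrAC -mulrBl; apply: mem_ideal_mul.
  have [w Hw] := IH f If.
  exists (local_const s (symbol idfun a c) * w).
  have [_ HD HM] := idHI m.+1.
  have := HD _ _ (mem_ideal_mul (combH c) If)
    (HM (local_const s (symbol idfun a c)) _ (HIS _ _ _ Ig Hw)).
  by rewrite telescope [g ^+ m.+2]exprS.
have expE m (q : nat -> 'I_s) : ideal_exp I m (\prod_(j < m) e (q j)).
  elim: m => [//|m IH]; rewrite big_ord_recr /= mulrC.
  by apply: mem_ideal_mul => //; apply: edges_ideal_edge.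
have prodH m (q : nat -> 'I_s) : HI m (\prod_(j < m.+1) e (q j) -
    local_const s (\prod_(j < m.+1) a (q j)) * g ^+ m.+1).
  elim: m => [|m IH].
    rewrite !big_ord1 expr1 -[X in HI _ X]mulr1; exact: mem_ideal_mul.
  have [_ HD HM] := idHI m.+1.
  rewrite big_ord_recr [X in local_const s X]big_ord_recr /= rmorphM.
  rewrite [X in HI _ (X - _)]mulrC [X in _ - X * _]mulrC [g ^+ m.+2]exprS.
  have := HD _ _ (mem_ideal_mul (edgeH (q m.+1)) (expE m.+1 q))
    (HM (local_const s (a (q m.+1))) _ (HIS _ _ _ Ig IH)).
  by rewrite telescope.
have nE : n = n.-1.+1 by rewrite prednK.
(* The binomial has degree [n], so it puts $g^n$ into $HI^{n-1}$. *)
exists n.-1; apply/seteqP; split; last first.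
  by apply: ideal_mulS => //; apply: hyperplane_sub.
have [_ HD HM] := idHI n.-1.
have gH : HI n.-1 (g ^+ n).
  (* The two products of edges cancel, leaving $g^n$ times the nonzero constant
     [evens a - odds a]. *)
  have := ideal_sub (idHI n.-1) (prodH n.-1 (fun j => z j.*2.+1))
    (prodH n.-1 (fun j => z j.*2)).
  rewrite -nE -/(evens e) -/(odds e) -/(evens a) -/(odds a) prod_edges_evens.
  move=> /(HM (local_const s (evens a - odds a)^-1)); congr (HI _ _).
  rewrite [X in _ * X](_ : _ = local_const s (evens a - odds a) * g ^+ n).
    by rewrite mulrA -rmorphM mulVf // rmorph1 mul1r.
  by rewrite rmorphB mulrBl opprB addrC addrA subrK.
move=> f /expH[w Hw]; rewrite -[f](subrK (w * g ^+ n.-1.+1)).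
by apply: HD => //; apply: HM; rewrite -nE.
Qed.

(** The indicators of the even and of the odd vertices have binomial 1 and -1. If both are
    orthogonal to [v], the unit vector at [i] is added to the indicator of the opposite parity: the
    pairing becomes [v i], and the binomial is unchanged because a unit vector has [evens] and
    [odds] zero. *)
Lemma separating_form (v : 'I_s -> k) i : v i != 0 ->
  exists a, evens a - odds a != 0 /\ \sum_j v j * a j != 0.
Proof.
move=> vi.
have oddz j : odd (z j) = odd j by rewrite zE odd_mod ?odd_double.
pose ev (j : 'I_s) : k := (~~ odd j)%:R; pose od (j : 'I_s) : k := (odd j)%:R.
have ev1 (a : 'I_s -> k) : (forall j, a (z j.*2) = 1) -> evens a = 1.
  by move=> a1; rewrite /evens big1.
have od1 (a : 'I_s -> k) : (forall j, a (z j.*2.+1) = 1) -> odds a = 1.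
  by move=> a1; rewrite /odds big1.
have N1 : 0 - 1 != 0 :> k by rewrite sub0r oppr_eq0 oner_neq0.
have z0 (a : nat -> k) : (forall j, a j = 0) -> \prod_(j < n) a j = 0.
  by move=> a0; case: n n_gt0 => [//|m] _; rewrite big_ord_recl a0 mul0r.
have [v0|v0] := eqVneq (\sum_j v j * ev j) 0; last first.
  exists ev; split=> //.
  rewrite ev1 => [|j]; last by rewrite /ev oddz odd_double.
  rewrite /odds (z0 (fun j => ev (z j.*2.+1))) ?subr0 ?oner_neq0 // => j.
  by rewrite /ev oddz /= odd_double.
have [w0|w0] := eqVneq (\sum_j v j * od j) 0; last first.
  exists od; split=> //.
  rewrite od1 => [|j]; last by rewrite /od oddz /= odd_double.
  rewrite /evens (z0 (fun j => od (z j.*2))) // => j.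
  by rewrite /od oddz /= odd_double.
have sumE (a : 'I_s -> k) : \sum_j v j * a j = 0 ->
    \sum_j v j * (a j + (j == i)%:R) != 0.
  move=> a0; under eq_bigr do rewrite mulrDr; rewrite big_split /= a0 add0r.
  rewrite (bigD1 i) //= eqxx mulr1 big1 ?addr0 // => j /negbTE->.
  by rewrite mulr0.
have neqz j : odd j != odd i -> (z j == i) = false.
  by move=> H; apply: contraNF H => /eqP <-; rewrite oddz.
case: (boolP (odd i)) => oi.
  exists (fun j => ev j + (j == i)%:R); split; last exact: sumE.
  rewrite ev1 => [|j]; last by rewrite /ev oddz odd_double neqz ?oi ?odd_double ?addr0.
  suff -> : odds (fun j => ev j + (j == i)%:R) = 0 by rewrite subr0 oner_neq0.
  rewrite -[RHS](odds_delta k i); apply: eq_bigr => j _.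
  by rewrite /ev oddz /= odd_double add0r.
exists (fun j => od j + (j == i)%:R); split; last exact: sumE.
rewrite od1 => [|j]; last first.
  by rewrite /od oddz /= odd_double neqz ?(negbTE oi) /= ?odd_double ?addr0.
suff -> : evens (fun j => od j + (j == i)%:R) = 0 by [].
rewrite -[RHS](evens_delta k i); apply: eq_bigr => j _.
by rewrite /od oddz /= odd_double add0r.
Qed.

(** * The core and the colon ideal *)

Lemma edges_ideal_reduction : reduction I I.
Proof. by split=> //; [apply: edges_ideal_ideal | exists 0%N]. Qed.

Lemma core_edges_ideal : core I = ideal_mul (@local_max k s) I.
Proof.
apply/seteqP; split=> [f coref|f mIf J]; last by move=> /reduction_sup; apply.
have [c fE] := coref _ edges_ideal_reduction.
rewrite fE; apply: ideal_sum => [|i _]; first exact: ideal_mul_ideal.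
apply: mem_ideal_mul (edges_ideal_edge _ i); apply/local_maxE/eqP.
apply: contraT => ci.
have [a [Fa ca]] := separating_form (v := fun i => residue (c i)) ci.
have := coref _ (hyperplane_reduction Fa); rewrite fE => /hyperplane_comb c0.
by move: ca; rewrite -[X in X != 0]/(symbol idfun a c) c0 eqxx.
Qed.

(** Otherwise [J] would be $I$, and minimality would make some hyperplane reduction equal to $I$,
    although its defining form is nonzero on an edge. *)
Lemma edges_ideal_not_minimal J : minimal_reduction J I -> ~ I `<=` J.
Proof.
move=> [[_ JI _] Jmin] IJ.
have [a [Fa _]] := separating_form (v := fun=> 1) (i := z 0) (oner_neq0 _).
have HJ : hyperplane a = J.
  apply: Jmin; first exact: hyperplane_reduction.
  by move=> f /hyperplane_sub /IJ.
have [i /eqP ai] := binomial_neq0 Fa; apply: ai.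
have : hyperplane a (comb (fun j => if j == i then 1 else 0)).
  by rewrite HJ comb_delta mul1r; apply/IJ/edges_ideal_edge.
move/hyperplane_comb; rewrite /symbol (bigD1 i) //= eqxx rmorph1 mul1r.
by rewrite big1 ?addr0 // => j /negbTE->; rewrite rmorph0 mul0r.
Qed.

(** The colon contains $\mathfrak{m}$ because $\mathfrak{m}I$ lies in [J]; a unit in it would force
    $I$ into [J]. *)
Lemma colon_edges_ideal J : minimal_reduction J I ->
  ideal_colon J I = @local_max k s.
Proof.
move=> minJ; have [redJ _] := minJ; have [[_ _ JM] _ _] := redJ.
apply/seteqP; split=> [f fIJ|f mf h Ih]; last first.
  by apply: (reduction_sup redJ); apply: mem_ideal_mul.
apply/local_maxE/eqP; apply: contraT => /residue_unit[u uf].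
case: (edges_ideal_not_minimal minJ) => h /fIJ Jfh.
by rewrite -[h]mul1r -uf -mulrA; apply: JM.
Qed.

End Core.

End Unicyclic.

(** * From the graph hypotheses to the indexing of edges by vertices *)

Section UnicyclicGraph.
Variables (s d : nat) (G : rel 'I_s).
Hypothesis d_gt2 : (2 < d)%N.
Hypothesis d_le_s : (d <= s)%N.
Hypothesis G_simple : simple_graph G.
Hypothesis G_conn : connected_graph G.
Hypothesis G_cycle : unique_cycle G (first_cycle s d).
Hypothesis G_leaf : forall j : 'I_s, (d <= j)%N -> leaf G j.

Let G_sym : ssrbool.symmetric G. Proof. by case: G_simple. Qed.
Let G_irr : irreflexive G. Proof. by case: G_simple. Qed.

Lemma modn_ltn_le j : (j %% d < s)%N.
Proof. by rewrite (leq_trans _ d_le_s) // ltn_pmod; lia. Qed.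

Definition cycle_vertex j : 'I_s := Ordinal (modn_ltn_le j).

(** Orients the cycle edges cyclically and the others from the leaf to the cycle, so that each
    vertex indexes one edge; the default [i] is excluded by [leaf_neighbour]. *)
Definition next_vertex (i : 'I_s) : 'I_s :=
  if (i < d)%N then cycle_vertex i.+1 else odflt i [pick y | G i y].

Local Notation z := cycle_vertex.
Local Notation t := next_vertex.

Lemma cycle_vertex_ltn j : (z j < d)%N.
Proof. by rewrite /= ltn_pmod; lia. Qed.

Lemma cycle_vertex_small (i : 'I_s) : (i < d)%N -> z i = i.
Proof. by move=> lt_i; apply: val_inj; rewrite /= modn_small. Qed.

Lemma next_cycle_vertex j : t (z j) = z j.+1.
Proof.
rewrite /next_vertex cycle_vertex_ltn; apply: val_inj => /=.
by rewrite -addn1 modnDml addn1.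
Qed.

Lemma set2_eq (T : finType) (a b x y : T) : [set a; b]%SET = [set x; y]%SET ->
  a = x /\ b = y \/ a = y /\ b = x.
Proof.
move=> E.
have /set2P a_xy : a \in [set x; y]%SET by rewrite -E set21.
have /set2P b_xy : b \in [set x; y]%SET by rewrite -E set22.
have /set2P x_ab : x \in [set a; b]%SET by rewrite E set21.
have /set2P y_ab : y \in [set a; b]%SET by rewrite E set22.
case: a_xy => ax; case: b_xy => bx; [left|left|right|left]; split;
  case: x_ab => xE; case: y_ab => yE; congruence.
Qed.

Lemma first_cycle_vertex j : [set z j; z j.+1]%SET \in first_cycle s d.
Proof.
apply/imsetP; exists (z j, z j.+1) => //.
by rewrite inE cycle_vertex_ltn /= -[(j %% d).+1]addn1 modnDml addn1.
Qed.

Lemma cycle_vertex_edge j : G (z j) (z j.+1).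
Proof.
have [[c /andP[_ /andP[Gc _]] cE] _] := G_cycle.
have := first_cycle_vertex j; rewrite -cE => /imsetP[x xc].
have := next_cycle Gc xc.
by move=> Gx /set2_eq[[-> ->]|[-> ->]] //; rewrite G_sym.
Qed.

Lemma cycle_vertex_path i m : path G (z i) (map z (iota i.+1 m)).
Proof. by elim: m i => //= m IH i; rewrite cycle_vertex_edge IH. Qed.

(* A chord {i, j} closes the path i, i + 1, ..., j into a cycle. *)
Lemma edge_first_cycle (i j : 'I_s) : (i < j < d)%N -> G i j ->
  [set i; j]%SET \in first_cycle s d.
Proof.
move=> /andP[lt_ij lt_jd] Gij; have lt_id := ltn_trans lt_ij lt_jd.
pose p := map z (iota i.+1 (j - i)).
have lastp : last i p = j.
  rewrite /p -[i in last i](cycle_vertex_small lt_id) last_map.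
  rewrite (_ : last _ _ = j :> nat) ?cycle_vertex_small //.
  by rewrite -nth_last size_iota -[X in nth X](add0n i) nth_iota; lia.
have uniqp : uniq (i :: p).
  rewrite -[i in i :: p](cycle_vertex_small lt_id) /p -[_ :: _]/(map z (iota i (j - i).+1)).
  rewrite map_inj_in_uniq ?iota_uniq // => x y; rewrite !mem_iota => xP yP.
  by move=> /(congr1 val) /=; rewrite !modn_small //; lia.
have Gp : cycle G (i :: p).
  rewrite /= rcons_path lastp G_sym Gij andbT.
  by rewrite -[i in path _ i](cycle_vertex_small lt_id) cycle_vertex_path.
(* For consecutive vertices the closed path has only two vertices and is no cycle, but the edge is
   then one of the listed ones. *)
have [jE|j_neq] := eqVneq (nat_of_ord j) i.+1.
  have := first_cycle_vertex i; rewrite cycle_vertex_small //.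
  by rewrite -jE cycle_vertex_small.
have cycp : graph_cycle G (i :: p).
  by rewrite /graph_cycle /ucycleb Gp uniqp /= size_map size_iota; lia.
have [_ /(_ _ cycp) <-] := G_cycle; apply/imsetP; exists j.
  by rewrite -lastp mem_last.
(* The chord is the closing edge of the new cycle, from its last vertex [j] back to [i]. *)
have : next (i :: p) (last i p) = i.
  by rewrite next_nth mem_last index_last // nth_default.
by rewrite lastp => ->; rewrite finset.setUC.
Qed.

Lemma leaf_neighbour (j : 'I_s) : (d <= j)%N ->
  G j (t j) /\ forall y, G j y -> y = t j.
Proof.
move=> le_j; rewrite /next_vertex ltnNge le_j /=.
have /eqP/cards1P[x Ex] := G_leaf le_j.
have GE y : G j y = (y == x) by rewrite -finset.in_set1 -Ex inE.
case: pickP => [y|/(_ x)]; rewrite GE ?eqxx // => /eqP -> /=.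
split=> [|w]; first by rewrite ?GE.
by rewrite GE => /eqP.
Qed.

Lemma next_vertex_edge i : G i (t i).
Proof.
have [lt_i|/leaf_neighbour[]//] := ltnP i d.
by rewrite -(cycle_vertex_small lt_i) next_cycle_vertex cycle_vertex_edge.
Qed.

(* Two adjacent leaves would form a connected component. *)
Lemma next_vertex_ltn i : (t i < d)%N.
Proof.
have [lt_i|le_i] := ltnP i d.
  by rewrite -(cycle_vertex_small lt_i) next_cycle_vertex cycle_vertex_ltn.
rewrite ltnNge; apply/negP => le_ti.
have [_ Gi] := leaf_neighbour le_i; have [_ Gti] := leaf_neighbour le_ti.
have tti : t (t i) = i by apply/esym/Gti; rewrite G_sym next_vertex_edge.
have clo : closed G (mem [set i; t i]%SET).
  apply: intro_closed; first exact: sym_connect_sym.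
  move=> x y Gxy /set2P[xE|xE]; rewrite xE in Gxy; apply/set2P.
    by right; apply: Gi.
  by left; rewrite -tti; apply: Gti.
have := closed_connect clo (G_conn i (z 0)); rewrite /= set21 => /esym/set2P[] zE.
  by have := cycle_vertex_ltn 0; rewrite zE ltnNge le_i.
by have := cycle_vertex_ltn 0; rewrite zE ltnNge le_ti.
Qed.

Lemma edge_next_vertex i j : G i j -> j = t i \/ i = t j.
Proof.
move=> Gij.
have [lt_i|le_i] := ltnP i d; last by left; have [_] := leaf_neighbour le_i; apply.
have [lt_j|le_j] := ltnP j d; last first.
  by right; have [_] := leaf_neighbour le_j; apply; rewrite G_sym.
have : [set i; j]%SET \in first_cycle s d.
  case: (ltngtP i j) => [lt_ij|lt_ji|/val_inj ij].
  - by apply: edge_first_cycle => //; rewrite lt_ij.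
  - by rewrite finset.setUC; apply: edge_first_cycle; rewrite ?lt_ji // G_sym.
  - by move: Gij; rewrite ij G_irr.
case/imsetP => -[x y]; rewrite inE /= => /andP[lt_x /eqP yE].
have -> : y = t x by rewrite /next_vertex lt_x; apply: val_inj.
by case/set2_eq => -[-> ->]; auto.
Qed.

Lemma edge_idealE (k : fieldType) : edge_ideal k G = @edges_ideal s t k.
Proof.
apply/seteqP; split.
  apply: ideal_gen_sub; first exact: edges_ideal_ideal.
  move=> _ [i [j [/edge_next_vertex[]-> ->]]]; first exact: edges_ideal_edge.
  by rewrite mulrC; apply: edges_ideal_edge.
move=> _ [c ->]; apply: ideal_sum => [|i _]; first exact: ideal_gen_ideal.
have [_ _ IM] := ideal_gen_ideal
  [set x | exists i j, G i j /\ x = to_local ('X_i * 'X_j : {mpoly k[s]})].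
apply: IM; apply: sub_ideal_gen; exists i, (t i); split=> //.
exact: next_vertex_edge.
Qed.

End UnicyclicGraph.

Theorem theorem4p6 (k : fieldType) (s d : nat) (G : rel 'I_s)
    (m : set (local_mpoly k s)) :
  infinite_set [set: k] ->
  simple_graph G ->
  connected_graph G ->
  (4 <= d)%N -> ~~ odd d -> (d <= s)%N ->
  unique_cycle G (first_cycle s d) ->
  (forall j : 'I_s, (d <= j)%N -> leaf G j) ->
  maximal_ideal m ->
  let I := edge_ideal k G in
  forall J : set (local_mpoly k s), minimal_reduction J I ->
    core I = ideal_mul (ideal_colon J I) I /\
    ideal_mul (ideal_colon J I) I = ideal_mul m I.
Proof.
move=> _ G_simple G_conn d_ge4 d_even d_le_s G_cycle G_leaf /maximal_idealE -> I J.
have d_gt2 : (2 < d)%N by apply: leq_trans d_ge4.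
have dE : d = d./2.*2 by rewrite even_halfK.
have n_gt1 : (1 < d./2)%N by rewrite -ltn_double -dE.
have zE j : cycle_vertex d_gt2 d_le_s j = (j %% d./2.*2)%N :> nat by rewrite -dE.
have tz := next_cycle_vertex G d_gt2 d_le_s.
have t_lt i : (next_vertex G d_gt2 d_le_s i < d./2.*2)%N.
  by rewrite -dE; apply: next_vertex_ltn.
rewrite /I (edge_idealE d_gt2 d_le_s) // => minJ.
rewrite (colon_edges_ideal n_gt1 zE tz t_lt minJ); split=> //.
exact: core_edges_ideal n_gt1 zE tz t_lt k.
Qed.
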